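(* There exists an absolute constant $c>0$ such that the following holds for every field $\mathbb{F}$ and every sufficiently large positive integer $n$: every fan-in $2$ noncommutative arithmetic circuit over $\mathbb{F}$ computing $\mathrm{Pal}_{n,n}(X,Y)$ has size at least $c\,n^2$. In other words, every such circuit has size $\Omega(n^2)$.
   Context: Let $\mathbb{F}$ be a field, and let $X=\{x_1,\dots,x_n\}$ and $Y=\{y_1,\dots,y_n\}$ be disjoint sets of noncommuting variables; $\mathbb{F}\langle X,Y\rangle$ is the free (noncommutative) polynomial ring. The palindrome polynomial is $$\mathrm{Pal}_{n,n}(X,Y)=\sum_{(i_1,\dots,i_n)\in[n]^n}\Bigl(\prod_{j=1}^n x_{i_j}\Bigr)\Bigl(\prod_{j=1}^n y_{i_{n+1-j}}\Bigr)=\sum_{(i_1,\dots,i_n)\in[n]^n} x_{i_1}x_{i_2}\cdots x_{i_n}\,y_{i_n}\cdots y_{i_2}y_{i_1}.$$ A fan-in $2$ noncommutative arithmetic circuit is a directed acyclic graph whose leaves are labeled by field constants or variables from $X\cup Y$, and whose internal nodes (gates) are labeled by $+$ or $\times$; every internal node has in-degree exactly $2$, and each $\times$ gate has a designated left and right child. Edges may be labeled by field constants, which scale the polynomial carried along the edge. Each gate computes a noncommutative polynomial in the natural way (a $\times$ gate computes (left input)$\cdot$(right input)). The circuit computes $f$ if some gate computes $f$. The size of the circuit is the total number of vertices of the graph. *)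

(* Defs.v *)
From HB Require Import structures.
From mathcomp Require Import all_boot all_order all_algebra.
From mathcomp Require Import monalg.

Set Implicit Arguments.
Unset Strict Implicit.
Unset Printing Implicit Defensive.

Import GRing.Theory.
Local Open Scope ring_scope.

(* [inl i] is the variable x_i and [inr i] the variable y_i. *)
Definition var (n : nat) : choiceType := ('I_n + 'I_n)%type.

(* The free algebra F<X,Y>, as the monoid algebra of the free monoid on X + Y. *)
Notation "{ 'ncpoly' F [ n ] }" := {malg F[{fmonom (var n)}]}
  (at level 0, F, n at level 2, format "{ 'ncpoly'  F [ n ] }") : type_scope.

Definition ncvar (F : fieldType) (n : nat) (z : var n) : {ncpoly F[n]} :=
  << fmu z >>.

(* Products are taken from left to right in increasing order of j. *)
Definition Pal (F : fieldType) (n : nat) : {ncpoly F[n]} :=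
  \sum_(i : {ffun 'I_n -> 'I_n})
    (\prod_(j < n) ncvar F (inl (i j) : var n)) *
    (\prod_(j < n) ncvar F (inr (i (rev_ord j)) : var n)).

Variant gate_op := Plus | Times.

(* [Gate o (a, u) (b, v)] has left child u and right child v; a and b are the
   labels of the two incoming edges (1 for an unlabeled edge). The children may
   coincide, in which case the two edges are parallel. *)
Variant node (F : fieldType) (n : nat) (V : Type) :=
  | Const of F
  | Var of var n
  | Gate of gate_op & F * V & F * V.

Arguments Const {F n V}.
Arguments Var {F n V}.
Arguments Gate {F n V}.

Definition edge_to (F : fieldType) (n : nat) (V : finType)
    (lab : V -> node F n V) : rel V :=
  fun u v => if lab v is Gate _ l r then (u == l.2) || (u == r.2) else false.

Record circuit (F : fieldType) (n : nat) := Circuit {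
  vertex : finType;
  label : vertex -> node F n vertex;
  circuit_acyclic :
    forall p : seq vertex, cycle (edge_to label) p -> p = [::]
}.

Definition circuit_size (F : fieldType) (n : nat) (C : circuit F n) : nat :=
  #|vertex C|.

Definition gate_eval (F : fieldType) (n : nat) (o : gate_op)
    (p q : {ncpoly F[n]}) : {ncpoly F[n]} :=
  match o with Plus => p + q | Times => p * q end.

(* By acyclicity, every vertex computes exactly one polynomial. *)
Inductive vertex_computes (F : fieldType) (n : nat) (C : circuit F n) :
    vertex C -> {ncpoly F[n]} -> Prop :=
  | ComputesConst v a of label v = Const a : vertex_computes v a%:MP
  | ComputesVar v z of label v = Var z : vertex_computes v (ncvar F z)
  | ComputesGate v o a u b w p q of
      label v = Gate o (a, u) (b, w) &
      vertex_computes u p & vertex_computes w q :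
      vertex_computes v (gate_eval o (a *: p) (b *: q)).

Definition computes (F : fieldType) (n : nat) (C : circuit F n)
    (f : {ncpoly F[n]}) : Prop :=
  exists v : vertex C, vertex_computes v f.

(* Main.v *)
(* Let [slice p v], for a nonempty word v in the y's, be the polynomial in the
   x's whose coefficient at u is that of u v in p. At a product gate,
     slice (p q) v = (p(0) + A) slice q v + sum_(v = v1 v2) q_v2 slice p v1,
   where A is the part of p in the x's alone, without constant term. Hence the
   slices of all gates lie in the span of the products A_i1 ... A_ir with
   i1 < ... < ir, where there is at most one A_i per gate. Products of more than
   n factors have no term of degree at most n, so for a circuit of size s this
   span has dimension at most C(s + n, n) modulo degree > n. As every x-word of
   length n is a slice of Pal, n^n <= C(s + n, n), whence n^2 <= 4 (s + n). *)
Require Import Defs.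
From mathcomp Require Import all_boot all_order all_algebra.
From mathcomp Require Import finmap monalg.
From mathcomp Require Import zify.

Set Implicit Arguments.
Unset Strict Implicit.
Unset Printing Implicit Defensive.

Import Order.TTheory GRing.Theory Num.Theory.
Local Open Scope ring_scope.

(** * Spans of ordered convolution products *)

Section OrderedProducts.

Variables (F : fieldType) (T : eqType).
Implicit Types (A h : seq T -> F) (As : seq (seq T -> F)) (u : seq T).

(** This is multiplication of noncommutative power series, on coefficient functions. *)
Definition conv A h u : F :=
  \sum_(k < (size u).+1) A (take k u) * h (drop k u).

(* The span of the products, for [conv], of subsequences of [As]. *)
Fixpoint prodspan As h : Prop :=
  if As is A :: As' then
    exists h1 h2, [/\ prodspan As' h1, prodspan As' h2 &
                      forall u, h u = h1 u + conv A h2 u]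
  else exists c, forall u, h u = c *+ (u == [::]).

Lemma eq_prodspan As h h' : h =1 h' -> prodspan As h -> prodspan As h'.
Proof.
move=> eqh; case: As => [|A As] /=.
  by case=> c hE; exists c => u; rewrite -eqh.
by case=> h1 [h2 [s1 s2 hE]]; exists h1, h2; split=> // u; rewrite -eqh.
Qed.

Lemma prodspan0 As : prodspan As (fun=> 0).
Proof.
elim: As => [|A As IH] /=; first by exists 0 => u; rewrite mul0rn.
exists (fun=> 0), (fun=> 0); split=> // u.
by rewrite add0r /conv big1 // => k _; rewrite mulr0.
Qed.

Lemma prodspan_one As c : prodspan As (fun u => c *+ (u == [::])).
Proof.
elim: As => [|A As IH] /=; first by exists c.
exists (fun u => c *+ (u == [::])), (fun=> 0).
split=> // [|u]; first exact: prodspan0.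
by rewrite [conv _ _ _]big1 ?addr0 // => k _; rewrite mulr0.
Qed.

Lemma prodspanD As h h' :
  prodspan As h -> prodspan As h' -> prodspan As (fun u => h u + h' u).
Proof.
elim: As h h' => [|A As IH] h h' /=.
  by case=> c hE [c' hE']; exists (c + c') => u; rewrite hE hE' mulrnDl.
case=> h1 [h2 [s1 s2 hE]] [h1' [h2' [s1' s2' hE']]].
exists (fun u => h1 u + h1' u), (fun u => h2 u + h2' u).
split; [exact: IH|exact: IH|move=> u].
rewrite hE hE' addrACA; congr (_ + _).
by rewrite -big_split /=; apply: eq_bigr => k _; rewrite mulrDr.
Qed.

Lemma prodspanZ As a h : prodspan As h -> prodspan As (fun u => a * h u).
Proof.
elim: As h => [|A As IH] h /=.
  by case=> c hE; exists (a * c) => u; rewrite hE mulrnAr.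
case=> h1 [h2 [s1 s2 hE]].
exists (fun u => a * h1 u), (fun u => a * h2 u); split; [exact: IH|exact: IH|].
move=> u; rewrite hE mulrDr; congr (_ + _).
by rewrite mulr_sumr; apply: eq_bigr => k _; rewrite mulrCA.
Qed.

Lemma prodspan_sum As (I : Type) (r : seq I) (h : I -> seq T -> F) :
  (forall i, prodspan As (h i)) -> prodspan As (fun u => \sum_(i <- r) h i u).
Proof.
move=> s; elim: r => [|i r IH].
  by apply: eq_prodspan (prodspan0 As) => u; rewrite big_nil.
by apply: eq_prodspan (prodspanD (s i) IH) => u; rewrite big_cons.
Qed.

Lemma prodspan_cons A As h : prodspan As h -> prodspan (A :: As) h.
Proof.
move=> s; exists h, (fun=> 0); split=> // [|u]; first exact: prodspan0.
by rewrite [conv _ _ _]big1 ?addr0 // => k _; rewrite mulr0.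
Qed.

Lemma prodspan_conv A As h : prodspan As h -> prodspan (A :: As) (conv A h).
Proof.
by move=> s; exists (fun=> 0), h; split=> // [|u];
  [exact: prodspan0|rewrite add0r].
Qed.

(* Modulo words longer than [d], [conv A h] depends only on [h] modulo words
   longer than [d - 1], hence Pascal's rule. *)
Lemma prodspan_rank As d :
    (forall i, (i < size As)%N -> nth (fun=> 0) As i [::] = 0) ->
  exists2 I : finType, (#|I| <= 'C(size As + d, d))%N &
  exists g : I -> seq T -> F, forall h, prodspan As h ->
  exists c : I -> F, forall u, (size u <= d)%N -> h u = \sum_i c i * g i u.
Proof.
elim: As d => [|A As IH] d As0 /=.
  exists unit; first by rewrite card_unit add0n binn.
  exists (fun _ u => (u == [::])%:R) => h [c hE]; exists (fun=> c) => u _.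
  by rewrite hE (big_pred1 tt) ?mulr_natr //; case.
have {}IH d' := IH d' (fun i lti => As0 i.+1 lti).
have /= A0 := As0 0%N (ltn0Sn _).
(* For [d = 0] only the empty word counts, and there [conv A h2] vanishes because [A [::] = 0]; no
   new generator arises. *)
case: d => [|d].
  have [I leI [g gP]] := IH 0%N.
  exists I; first by rewrite bin0; rewrite bin0 in leI.
  exists g => h [h1 [h2 [/gP[c cP] _ hE]]]; exists c => -[|//] _.
  by rewrite hE /conv big_ord1 /= A0 mul0r addr0 cP.
have [I leI [g gP]] := IH d.+1; have [J leJ [g' gP']] := IH d.
exists (I + J)%type.
  (* The bound on [#|J|] is relaxed to ['C(size As + d.+1, d)], the second term of Pascal's rule. *)
  rewrite card_sum addSn binS leq_add // (leq_trans leJ) //.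
  by apply: leq_bin2l; rewrite addnS.
exists (fun k => match k with inl i => g i | inr j => conv A (g' j) end).
move=> h [h1 [h2 [/gP[c cP] /gP'[c' cP'] hE]]].
exists (fun k => match k with inl i => c i | inr j => c' j end) => u leu.
rewrite big_sumType /= hE -cP //; congr (_ + _).
under [RHS]eq_bigr do rewrite mulr_sumr.
(* The empty prefix contributes 0; any other leaves a suffix of length at most [d], where [cP']
   applies. *)
rewrite exchange_big; apply: eq_bigr => -[[|k] ltk] _ /=.
  by rewrite take0 A0 mul0r big1 // => j _; rewrite mul0r mulr0.
rewrite cP' ?size_drop; last by lia.
by rewrite mulr_sumr; apply: eq_bigr => j _; rewrite mulrCA.
Qed.

End OrderedProducts.

(** * Slices of noncommutative polynomials *)

Section Slices.

Variables (F : fieldType) (n : nat).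
Implicit Types (p q : {ncpoly F[n]}) (w : seq (var n)) (u v : seq 'I_n).

Definition coef p w : F := p@_(FMonom w).

Lemma coef_supp p w : coef p w = \sum_(m <- msupp p) p@_m *+ (m == FMonom w).
Proof.
rewrite /coef {1}(monalgE p) raddf_sum; apply: eq_bigr => m _.
exact: mcoeffU.
Qed.

(** By bilinearity, a pair of monomials [w1], [w2] contributes only if [w] is [w1 ++ w2], through
    the single cut at [size w1]. *)
Lemma coefM p q w : coef (p * q) w = conv (coef p) (coef q) w.
Proof.
rewrite {1}/coef mcoeffMl /conv; symmetry.
under eq_bigr do rewrite !coef_supp mulr_suml.
rewrite exchange_big; apply: eq_bigr => m1 _ /=.
under eq_bigr do rewrite mulr_sumr.
rewrite exchange_big; apply: eq_bigr => m2 _ /=.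
case: m1 m2 => [w1] [w2].
have -> : mmul (FMonom w1) (FMonom w2) = FMonom (w1 ++ w2).
  by apply: val_inj; exact: fmM.
have eqFM (x y : seq (var n)) : (FMonom x == FMonom y) = (x == y) by [].
under eq_bigr do rewrite mulrnAl mulrnAr -mulrnA !eqFM.
rewrite eqFM; case: eqP => [<-|neq].
  have lt1 : (size w1 < (size (w1 ++ w2)).+1)%N by rewrite size_cat; lia.
  rewrite (bigD1 (Ordinal lt1)) //= take_size_cat // drop_size_cat // !eqxx.
  rewrite big1 ?addr0 // => k /eqP nek.
  case: (w1 =P _) => [e1|]; last by rewrite muln0.
  case: nek; apply: val_inj => /=; rewrite [in RHS]e1 size_takel //.
  by rewrite -ltnS.
rewrite big1 // => k _; case: eqP => [e1|]; last by rewrite mul0n.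
by case: eqP => // e2; case: neq; rewrite e1 e2 cat_take_drop.
Qed.

Definition xword u : seq (var n) := map inl u.
Definition yword v : seq (var n) := map inr v.

Definition slice p v u : F := coef p (xword u ++ yword v).

(** The constant term is dropped so that convolving with [xpart p] raises degrees, as
    [prodspan_rank] requires. *)
Definition xpart p u : F := if u is [::] then 0 else coef p (xword u).

Lemma sliceD p q v u : slice (p + q) v u = slice p v u + slice q v u.
Proof. exact: mcoeffD. Qed.

Lemma sliceZ a p v u : slice (a *: p) v u = a * slice p v u.
Proof. exact: mcoeffZ. Qed.

(** The three terms collect the cuts of the word before its first letter, after a nonempty prefix of
    [u], and after at least one letter of [v]. An empty [u] leaves nothing for the second. If [v] is
    nonempty, so is the word of every slice on the right. *)
Lemma sliceM p q v u :
  slice (p * q) v u =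
    coef p [::] * slice q v u + conv (xpart p) (slice q v) u +
    \sum_(k < size v) coef q (yword (drop k.+1 v)) * slice p (take k.+1 v) u.
Proof.
rewrite /slice coefM /conv size_cat !size_map -addSn big_split_ord /=.
congr (_ + _); last first.
  apply: eq_bigr => k _; rewrite addSnnS mulrC take_cat drop_cat size_map.
  have -> : (size u + k.+1 < size u)%N = false by lia.
  by rewrite addKn /yword map_take map_drop.
rewrite 2!big_ord_recl /= !take0 !drop0 mul0r add0r; congr (_ + _).
apply: eq_bigr => k _; rewrite /bump add1n.
case: k => k ltk /=; case: u ltk => [//|a u] /= ltk.
rewrite take_cat drop_cat size_map.
case: (ltnP k (size u)) => [lt|ge]; first by rewrite /xword map_take map_drop.
have -> : k = size u by apply/eqP; rewrite eqn_leq ge -ltnS ltk.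
by rewrite subnn take0 drop0 cats0 take_size drop_size.
Qed.

Lemma coefC a w : coef (a%:MP : {ncpoly F[n]}) w = a *+ (w == [::]).
Proof. by rewrite /coef mcoeffC -fm1. Qed.

Lemma coef_ncvar z w : coef (ncvar F z) w = (w == [:: z])%:R.
Proof. by rewrite /coef /ncvar mcoeffU1 eq_sym -fmU. Qed.

Lemma prod_ncvar (I : Type) (r : seq I) (f : I -> var n) :
  \prod_(i <- r) ncvar F (f i) = << FMonom (map f r) >>.
Proof.
elim: r => [|i r IH].
  rewrite big_nil /= -[1]/(<< 1%:R *g mone >>); congr << _ *g _ >>.
  by apply: val_inj; exact: fm1.
rewrite big_cons IH /ncvar malgM_def fgmulUU mulr1; congr << _ *g _ >>.
by apply: val_inj; rewrite /= fmM fmU.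
Qed.

(** The y's of [Pal] come in reverse order, so the term of index [i] is the word read here exactly
    when [i] lists both [w] and [w']. *)
Lemma slice_Pal (w w' : n.-tuple 'I_n) :
  slice (Pal F n) (rev w) w' = (w == w')%:R.
Proof.
rewrite /slice /coef /Pal raddf_sum /=.
have E (i : {ffun 'I_n -> 'I_n}) :
    ((\prod_(j < n) ncvar F (inl (i j) : var n)) *
     (\prod_(j < n) ncvar F (inr (i (rev_ord j)) : var n)))
      @_(FMonom (xword w' ++ yword (rev w))) =
    ((codom i == w') && (codom i == w))%:R.
  rewrite !prod_ncvar malgM_def fgmulUU mulr1 mcoeffU1.
  have enumE : index_enum 'I_n = enum 'I_n.
    by rewrite enumT [index_enum _]unlock.
  have -> : mmul (FMonom [seq (inl (i j) : var n) | j <- index_enum 'I_n])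
      (FMonom [seq (inr (i (rev_ord j)) : var n) | j <- index_enum 'I_n]) =
      FMonom (xword (codom i) ++ yword (rev (codom i))).
    apply: val_inj; rewrite /= fmM /= enumE; congr (_ ++ _).
      by rewrite /xword codomE -map_comp.
    rewrite /yword codomE -map_rev -map_comp.
    have -> : rev (enum 'I_n) = [seq rev_ord j | j <- enum 'I_n].
      apply: (inj_map val_inj); rewrite map_rev val_enum_ord -map_comp.
      apply: (@eq_from_nth _ 0%N) => [|k].
        by rewrite size_rev size_iota size_map size_enum_ord.
      rewrite size_rev size_iota => ltk.
      rewrite nth_rev ?size_iota // nth_iota; last by lia.
      rewrite (nth_map (Ordinal ltk)) ?size_enum_ord //=.
      by rewrite nth_enum_ord //; lia.
    by rewrite -[RHS]map_comp.
  have inlI : injective (inl : 'I_n -> var n) by move=> x y [].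
  have inrI : injective (inr : 'I_n -> var n) by move=> x y [].
  rewrite -[_ == _]/(xword (codom i) ++ yword (rev (codom i)) ==
    xword w' ++ yword (rev w)) eqseq_cat; last first.
    by rewrite !size_map -enumT size_enum_ord size_tuple.
  rewrite (inj_eq (inj_map inlI)) (inj_eq (inj_map inrI)).
  by rewrite (inj_eq (can_inj revK)).
under eq_bigr do rewrite E.
have codom_w (i : {ffun 'I_n -> 'I_n}) :
    (codom i == w) = (i == [ffun j => tnth w j]).
  apply/eqP/eqP => [cw|->].
    apply/ffunP => j; rewrite ffunE (tnth_nth j) -cw codomE.
    by rewrite (nth_map j) ?nth_ord_enum // size_enum_ord.
  rewrite codomE -[RHS]map_tnth_enum.
  by apply: eq_map => j; rewrite ffunE.
under eq_bigr do rewrite codom_w.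
rewrite (bigD1 [ffun j => tnth w j]) //= big1 => [|i /negPf->]; last first.
  by rewrite andbF.
have /eqP -> : codom [ffun j => tnth w j] == w by rewrite codom_w.
by rewrite eqxx andbT addr0.
Qed.

End Slices.

(** * Slices of the gates of a circuit *)

Section Circuits.

Variables (F : fieldType) (n : nat) (C : circuit F n).
Implicit Types (x : vertex C) (p q : {ncpoly F[n]}) (l : seq (vertex C)).

Lemma vertex_computes_inv x p : vertex_computes x p ->
  match label x with
  | Const a => p = a%:MP
  | Var z => p = ncvar F z
  | Gate o (a, u) (b, w) => exists q r,
      [/\ vertex_computes u q, vertex_computes w r &
          p = gate_eval o (a *: q) (b *: r)]
  end.
Proof.
by case=> [y a ->|y z ->|y o a u b w q r -> cu cw] //; exists q, r.
Qed.

Lemma vertex_computes_inj x p q :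
  vertex_computes x p -> vertex_computes x q -> p = q.
Proof.
move=> cx; elim: cx q => {x p} [x a Lx|x z Lx|x o a u b w p q Lx _ IHp _ IHq] r
  /vertex_computes_inv; rewrite Lx // => -[p' [q' [cu cw ->]]].
by rewrite (IHp _ cu) (IHq _ cw).
Qed.

(** The slice at the empty word is the pure x part, which need not lie in the span. *)
Definition slices_in As l : Prop :=
  forall x p, x \in l -> vertex_computes x p ->
  forall v, v != [::] -> prodspan As (slice p v).

Definition admissible As l : Prop :=
  [/\ uniq l, (size As <= size l)%N,
      forall i, (i < size As)%N -> nth (fun=> 0) As i [::] = 0 &
      slices_in As l].

(** A sum gate stays in the span of [As]; in [sliceM] only the convolution term leaves it, and
    [xpart p] is the one new factor. *)
Lemma prodspan_gate As o p q v : v != [::] ->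
    (forall v, v != [::] -> prodspan As (slice p v)) ->
    (forall v, v != [::] -> prodspan As (slice q v)) ->
  prodspan (xpart p :: As) (slice (gate_eval o p q) v).
Proof.
move=> v0 sp sq; case: o => /=.
  apply/prodspan_cons/(eq_prodspan _ (prodspanD (sp v v0) (sq v v0))) => u.
  by rewrite sliceD.
have s1 := prodspan_cons (xpart p) (prodspanZ (coef p [::]) (sq v v0)).
have s2 := prodspanD s1 (prodspan_conv (xpart p) (sq v v0)).
have s3 (k : 'I_(size v)) : prodspan (xpart p :: As)
    (fun u => coef q (yword (drop k.+1 v)) * slice p (take k.+1 v) u).
  apply/prodspan_cons/prodspanZ/sp.
  by rewrite -size_eq0 size_takel // ltn_ord.
apply: eq_prodspan (prodspanD s2 (prodspan_sum _ s3)) => u.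
by rewrite sliceM.
Qed.

Lemma admissible_cons As l x p A : admissible As l -> x \notin l ->
    vertex_computes x p -> A [::] = 0 ->
    (forall v, v != [::] -> prodspan (A :: As) (slice p v)) ->
  admissible (A :: As) (x :: l).
Proof.
move=> [Ul leAs As0 sl] xl cx A0 sx; split; rewrite /= ?xl ?Ul //.
  by case.
move=> y q; rewrite inE => /predU1P[->|yl] cy v v0; last first.
  exact/prodspan_cons/(sl y).
by rewrite (vertex_computes_inj cy cx); apply: sx.
Qed.

(** Induction on the evaluation, threading the lists through the left child and then the right one,
    so that a shared vertex is counted once. *)
Lemma computes_admissible x p As l : vertex_computes x p -> admissible As l ->
  exists As' l', [/\ admissible As' l', {subset l <= l'} & x \in l'].
Proof.
have base y q (As1 : seq (seq 'I_n -> F)) l1 : admissible As1 l1 ->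
    vertex_computes y q ->
    (exists2 A, A [::] = 0 &
      forall v, v != [::] -> prodspan (A :: As1) (slice q v)) ->
    exists As' l', [/\ admissible As' l', {subset l1 <= l'} & y \in l'].
  move=> adm cy [A A0 sA]; have [yl|yl] := boolP (y \in l1).
    by exists As1, l1; split.
  exists (A :: As1), (y :: l1); split; rewrite ?mem_head //.
    exact: admissible_cons adm yl cy A0 sA.
  by move=> z zl; rewrite inE zl orbT.
move=> cx; elim: cx As l => {x p}.
- move=> x a Lx As l adm; apply: (base _ _ _ _ adm (ComputesConst Lx)).
  exists (fun=> 0) => // v v0; apply: eq_prodspan (prodspan0 _) => u.
  by rewrite /slice coefC; case: u v v0 => [|? ?] [|? ?].
- move=> x z Lx As l adm; apply: (base _ _ _ _ adm (ComputesVar Lx)).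
  exists (fun=> 0) => // v v0.
  (* As [v] is nonempty, a nonempty [u] gives a word of length at least 2, never a single
     variable. *)
  apply: eq_prodspan (prodspan_one _ (yword v == [:: z])%:R) => u.
  rewrite /slice coef_ncvar; case: u => [|a u] //=.
  rewrite mulr0n eqseq_cons.
  by case: v v0 u => // b v _ [|? ?]; rewrite andbF.
move=> x o a u b w p q Lx cu IHu cw IHw As l adm.
have [As1 [l1 [adm1 sub1 ul1]]] := IHu _ _ adm.
have [As2 [l2 [adm2 sub2 wl2]]] := IHw _ _ adm1.
have [|As3 [l3 [adm3 sub3 xl3]]] := base _ _ _ _ adm2 (ComputesGate Lx cu cw).
  exists (xpart (a *: p)) => // v v0; have [_ _ _ sl] := adm2.
  apply: prodspan_gate => // v' v'0.
    apply: eq_prodspan (prodspanZ a (sl u p (sub2 _ ul1) cu v' v'0)) => t.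
    by rewrite sliceZ.
  apply: eq_prodspan (prodspanZ b (sl w q wl2 cw v' v'0)) => t.
  by rewrite sliceZ.
by exists As3, l3; split=> // y /sub1/sub2/sub3.
Qed.

(** By [slice_Pal], the identity matrix of order [n ^ n] factors through the index set [I] of the
    generators, so its rank is at most [#|I|]. *)
Lemma Pal_count : (0 < n)%N -> computes C (Pal F n) ->
  (n ^ n <= 'C(circuit_size C + n, n))%N.
Proof.
move=> n0 [x cx].
have adm0 : admissible [::] [::] by split.
have [As [l [[Ul leAs As0 sl] _ xl]]] := computes_admissible cx adm0.
have [I leI [g gP]] := prodspan_rank n As0.
pose T : finType := n.-tuple 'I_n.
have /fin_all_exists[c cP] (w : n.-tuple 'I_n) : exists c : I -> F,
    forall w' : n.-tuple 'I_n, (w == w')%:R = \sum_i c i * g i w'.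
  have w0 : rev w != [::] by rewrite -size_eq0 size_rev size_tuple -lt0n.
  have [c cP] := gP _ (sl x _ xl cx _ w0).
  by exists c => w'; rewrite -slice_Pal cP // size_tuple.
pose M := \matrix_(i < #|T|, j < #|I|) c (enum_val i) (enum_val j).
pose N := \matrix_(i < #|I|, j < #|T|) g (enum_val i) (enum_val j : T).
have MN1 : M *m N = 1%:M.
  apply/matrixP => i j; rewrite !mxE -(inj_eq enum_val_inj) cP.
  rewrite (reindex _ (onW_bij _ (enum_val_bij I))) /=.
  by apply: eq_bigr => k _; rewrite !mxE.
have : (#|T| <= #|I|)%N.
  by rewrite -(mxrank1 F #|T|) -MN1 mulmx_max_rank.
rewrite card_tuple card_ord => leT; apply: leq_trans leT (leq_trans leI _).
apply/leq_bin2l; rewrite leq_add2r (leq_trans leAs) //.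
by rewrite -(card_uniqP Ul) max_card.
Qed.

End Circuits.

(** * Numerical estimates and the quadratic bound *)

Lemma bin_le_exp2 m k : ('C(m, k) <= 2 ^ m)%N.
Proof.
have [ltmk|lekm] := ltnP m k; first by rewrite bin_small.
rewrite -[2%N]/(1 + 1)%N expnDn (bigD1 (Ordinal (lekm : (k < m.+1)%N))) //=.
by rewrite !exp1n !muln1 leq_addr.
Qed.

Lemma expn_self_le_fact n : (n ^ n <= 4 ^ n * n`!)%N.
Proof.
apply: (@leq_trans ('C(n + n, n) * n`!)).
  rewrite bin_ffact ffact_prod.
  have <- : (\prod_(i < n) n = n ^ n)%N by rewrite prod_nat_const card_ord.
  by apply: leq_prod => i _; have := ltn_ord i; lia.
rewrite leq_mul2r -[4%N]/(2 ^ 2)%N -expnM mulnC muln2 -addnn.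
by rewrite bin_le_exp2 orbT.
Qed.

Lemma bin_fact_le_expn m n : ('C(m, n) * n`! <= m ^ n)%N.
Proof.
rewrite bin_ffact ffact_prod.
have <- : (\prod_(i < n) m = m ^ n)%N by rewrite prod_nat_const card_ord.
by apply: leq_prod => i _; lia.
Qed.

Theorem theorem12 :
  exists2 c : rat, 0 < c &
  exists N : nat,
  forall (F : fieldType) (n : nat), (N <= n)%N ->
  forall C : circuit F n, computes C (Pal F n) ->
    c * n%:R ^+ 2 <= (circuit_size C)%:R.
Proof.
(* The target is [n * n <= 4 * (s + n)]; for [n >= 8] the term [4 * n] is at most half of [n * n],
   whence the constant 1/8. *)
exists 8%:R^-1 => //; exists 8%N => F n len C cP.
have n0 : (0 < n)%N by lia.
set s := circuit_size C.
have le1 : (n ^ n * n ^ n <= 4 ^ n * (s + n) ^ n)%N.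
  apply: leq_trans (leq_mul (Pal_count n0 cP) (expn_self_le_fact n)) _.
  by rewrite mulnCA leq_mul2l bin_fact_le_expn orbT.
rewrite -!expnMn leq_exp2r // in le1.
rewrite ler_pdivrMl // -natrX -natrM ler_nat -/s.
nia.
Qed.
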